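(* The compression semigroup $\Gamma$ of the dual Vinberg cone $\Omega$ does not have the contraction property with respect to the canonical Riemannian metric on $\Omega$: there exist $g\in\Gamma$, $x\in\Omega$ and $v\in V$ such that $$(J(g,x)v\,|\,J(g,x)v)_{g(x)} > (v|v)_x,$$ where $J(g,x)$ denotes the Jacobi matrix (differential) of $g$ at $x$.
   Context: Let $V$ be the space of real symmetric matrices $x=\begin{pmatrix} x_1 & 0 & x_4 \\ 0 & x_2 & x_5 \\ x_4 & x_5 & x_3 \end{pmatrix}$ with inner product $(x|y)=\mathrm{tr}(xy)$, let $V'=\{\mathrm{diag}(u_1,u_2,0): u_1,u_2\in\mathbb{R}\}\subset V$, and let $\Omega=\{x\in V: x \text{ positive definite}\}$ (the dual Vinberg cone). Its dual cone is $\Omega^*=\{\xi\in V: (x|\xi)>0\ \forall x\in\overline{\Omega}\setminus\{0\}\}$ and its characteristic function is $\varphi_\Omega(x)=\int_{\Omega^*}e^{-(x|\xi)}\,d\xi$ for $x\in\Omega$ ($d\xi$ a Lebesgue measure on $V$). The canonical Riemannian metric on $\Omega$ is $$(v|v')_x=D_vD_{v'}\log\varphi_\Omega(x)\qquad(v,v'\in V,\ x\in\Omega),$$ where $D_v$ is the directional derivative in direction $v$. Let $T_\Omega=V+i\Omega\subset V_{\mathbb{C}}$, and let $G(T_\Omega)$ be the identity component of the group of holomorphic automorphisms of $T_\Omega$. Let $H'$ be the set of real matrices $\begin{pmatrix} a_1 & 0 & 0 \\ 0 & a_2 & 0 \\ a_4 & a_5 & a_3 \end{pmatrix}$ with $a_3>0$,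 and let $W$ be the set of real matrices $\begin{pmatrix} x_1 & 0 & x_6 \\ 0 & x_2 & x_7 \\ x_4 & x_5 & x_3 \end{pmatrix}$. Let $\mathrm{Sp}(6,\mathbb{R})=\{g\in \mathrm{GL}(6,\mathbb{R}): gJg^T=J\}$ with $J=\begin{pmatrix} 0 & -I \\ I & 0 \end{pmatrix}$, and $$G=\left\{\begin{pmatrix} A & B \\ C & D \end{pmatrix}\in \mathrm{Sp}(6,\mathbb{R}) : A\in H',\ B\in W,\ C\in V',\ D^T\in H'\right\},$$ a subgroup of $\mathrm{Sp}(6,\mathbb{R})$. The linear fractional action $g\cdot z=(Az+B)(Cz+D)^{-1}$ induces an isomorphism of $G$ onto $G(T_\Omega)$, by which the two groups are identified. For real points the action is given by the same formula wherever $Cx+D$ is invertible, and one writes $g(x)=g\cdot x$. Compression semigroup: $\Gamma=\{g\in G(T_\Omega): g\cdot\Omega\subset\Omega\}$, i.e. the $g\in G$ such that for every $x\in\Omega$ the matrix $Cx+D$ is invertible and $g\cdot x\in\Omega$. *)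

(* Defs.v *)
From HB Require Import structures.
From mathcomp Require Import all_boot all_order all_algebra.
From mathcomp Require Import all_classical all_reals all_analysis.
Import Order.TTheory GRing.Theory Num.Theory.
Import numFieldNormedType.Exports.

Set Implicit Arguments.
Unset Strict Implicit.
Unset Printing Implicit Defensive.

Local Open Scope classical_set_scope.
Local Open Scope ring_scope.

Definition mat3 (R : realType) (s : seq (seq R)) : 'M[R]_3 :=
  \matrix_(i < 3, j < 3) nth 0 (nth [::] s i) j.

Definition Vmat (R : realType) (t : R * R * R * R * R) : 'M[R]_3 :=
  let: (x1, x2, x3, x4, x5) := t in
  mat3 [:: [:: x1; 0;  x4];
           [:: 0;  x2; x5];
           [:: x4; x5; x3]].

(* V is a linear subspace of 'M[R]_3, from which it takes its topology, and its
   points and tangent vectors are elements of 'M[R]_3. *)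
Definition V (R : realType) : set 'M[R]_3 := range (@Vmat R).

Definition V' (R : realType) : set 'M[R]_3 :=
  [set x | exists u1 u2, x = mat3 [:: [:: u1; 0;  0];
                                      [:: 0;  u2; 0];
                                      [:: 0;  0;  0]]].

Definition inner (R : realType) (x y : 'M[R]_3) : R := \tr (x *m y).

Definition posdef (R : realType) (x : 'M[R]_3) : Prop :=
  x^T = x /\ forall u : 'cV[R]_3, u != 0 -> 0 < (u^T *m x *m u) 0 0.

Definition Omega (R : realType) : set 'M[R]_3 := [set x | V x /\ posdef x].

Definition dual_Omega (R : realType) : set 'M[R]_3 :=
  [set xi | V xi /\
    forall x, (closure (@Omega R) `\ 0) x -> 0 < inner x xi].

(* The Lebesgue measures on V are the positive multiples of the one read in the
   coordinates of Vmat; c > 0 is the normalization. *)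
Definition lebesgueV (R : realType) (c : {posnum R}) :
    {measure set (measurableTypeR R * measurableTypeR R * measurableTypeR R *
                  measurableTypeR R * measurableTypeR R)%type -> \bar R} :=
  mscale (c%:num)%:nng
    (lebesgue_measure (R := R) \x lebesgue_measure (R := R) \x
     lebesgue_measure (R := R) \x lebesgue_measure (R := R) \x
     lebesgue_measure (R := R))%E.

Definition charfun (R : realType) (c : {posnum R}) (x : 'M[R]_3) : R :=
  \int[lebesgueV c]_(t in @Vmat R @^-1` @dual_Omega R)
    expR (- inner x (Vmat t)).

(* For x in Omega and v, w in V only values of charfun on Omega matter. *)
Definition metric (R : realType) (c : {posnum R}) (x v w : 'M[R]_3) : R :=
  'D_v (fun y => 'D_w (fun z => ln (charfun c z)) y) x.

Definition H' (R : realType) : set 'M[R]_3 :=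
  [set a | exists a1 a2 a3 a4 a5, 0 < a3 /\
     a = mat3 [:: [:: a1; 0;  0];
                  [:: 0;  a2; 0];
                  [:: a4; a5; a3]]].

Definition W (R : realType) : set 'M[R]_3 :=
  [set x | exists x1 x2 x3 x4 x5 x6 x7,
     x = mat3 [:: [:: x1; 0;  x6];
                  [:: 0;  x2; x7];
                  [:: x4; x5; x3]]].

Definition Jmx (R : realType) : 'M[R]_(3 + 3) :=
  block_mx 0 (- 1%:M) 1%:M 0.

Definition Sp6 (R : realType) : set 'M[R]_(3 + 3) :=
  [set g | g \in unitmx /\ g *m Jmx R *m g^T = Jmx R].

Definition G (R : realType) : set 'M[R]_(3 + 3) :=
  [set g | [/\ Sp6 g, H' (ulsubmx g), W (ursubmx g),
               V' (dlsubmx g) & H' (drsubmx g)^T]].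

Definition denom (R : realType) (g : 'M[R]_(3 + 3)) (z : 'M[R]_3) : 'M[R]_3 :=
  dlsubmx g *m z + drsubmx g.

(* Meaningful where denom g z is invertible. *)
Definition act (R : realType) (g : 'M[R]_(3 + 3)) (z : 'M[R]_3) : 'M[R]_3 :=
  (ulsubmx g *m z + ursubmx g) *m invmx (denom g z).

Definition Gamma (R : realType) : set 'M[R]_(3 + 3) :=
  [set g | G g /\
    forall x, Omega x -> denom g x \in unitmx /\ Omega (act g x)].

(* The formula for act g is smooth on a neighbourhood in 'M[R]_3 of any point of
   Omega where denom g is invertible; its differential restricts on V to that of
   g as a map on Omega. *)
Definition jac (R : realType) (g : 'M[R]_(3 + 3)) (x v : 'M[R]_3) : 'M[R]_3 :=
  'd (act g) x v.

(* Main.v *)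
(* Computing the Gaussian and exponential integrals of the characteristic
   function on the dual cone
     xi3 > 0, xi4^2 < xi1 xi3, xi5^2 < xi2 xi3
   gives, up to an additive constant,
     log phi(x) = -3/2 ln x1 - 3/2 ln x2 - 2 ln (x3 - x4^2/x1 - x5^2/x2)
                = -2 ln (det x) + 1/2 ln x1 + 1/2 ln x2.
   The contribution of -2 ln (det x) to the metric is contracted by translations
   by positive semidefinite b, but that of the other two terms increases with x1
   and x2.  For b = w w^T of rank one and v with b x^-1 v = 0, translation by b
   leaves the first contribution unchanged, so it strictly increases the length
   of v as soon as v1 and b1 are nonzero.  With v = E11, w = (1, 0, 2) and
   x = [[1,0,1],[0,1,0],[1,0,2]] the squared length grows from 15/2 to 63/8. *)
Require Import Defs.
From HB Require Import structures.
From mathcomp Require Import all_boot all_order all_algebra.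
From mathcomp Require Import all_classical all_reals all_analysis.
From mathcomp Require Import measurable_realfun.
From mathcomp Require Import ring lra.
Import Order.TTheory GRing.Theory Num.Theory.
Import numFieldNormedType.Exports.
Set Implicit Arguments.
Unset Strict Implicit.
Unset Printing Implicit Defensive.
Local Open Scope classical_set_scope.
Local Open Scope ring_scope.

(** * One-dimensional integrals *)
Section integrals.
Variable R : realType.
Notation mu := (@lebesgue_measure R).

(** Fundamental theorem of calculus on a half-line, whose endpoint is negligible. The integrand is
    extended by zero to the whole line because the iterated integrals of Tonelli's theorem run over
    all of [R]. *)
Lemma integral_ray (g F : R -> R) (l b : R) :
    (forall x, b <= x -> 0 <= g x) -> continuous g ->
    (forall x : R, is_derive x 1 F (g x)) -> F x @[x --> +oo] --> l ->
  (\int[mu]_t (if b < t then g t else 0)%:E = (l - F b)%:E)%E.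
Proof.
move=> g0 cg dF Fl.
have cF : continuous F.
  by move=> x; apply: differentiable_continuous; apply/derivable1_diffP; case: (dF x).
rewrite EFinB -(@ge0_continuous_FTC2y _ g F b l) //.
- rewrite -integral_itv_obnd_cbnd; last first.
    apply/measurable_funTS/measurable_EFinP.
    exact: continuous_measurable_fun.
  rewrite [RHS]integral_mkcond; apply: eq_integral => t _.
  rewrite patchE; case: ifPn => bt.
    by rewrite ifT// inE/= in_itv/= andbT.
  by rewrite ifF//; apply/negbTE; rewrite notin_setE/= in_itv/= andbT; exact/negP.
- exact: continuous_subspaceT.
- by apply: cvg_at_right_filter; exact: cF.
- by move=> x _; rewrite derive1E; have [] := dF x.
Qed.

Lemma cvg_expRN (s : R) : 0 < s -> expR (- (s * t)) @[t --> +oo] --> 0.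
Proof.
move=> s0.
apply: (@cvg_comp _ _ _ _ (fun z => expR (- z)) _ (pinfty_nbhs R)); last exact: cvgr_expR.
exact: gt0_cvgMry.
Qed.

Lemma continuous_expRN (s : R) : continuous (fun t => expR (- (s * t))).
Proof.
move=> x; apply: continuous_comp; last exact: continuous_expR.
by apply: (@continuousN _ R^o); exact: mulrl_continuous.
Qed.

Lemma integral_expR_ray (a b : R) : 0 < a ->
  (\int[mu]_t (if b < t then expR (- (a * t)) else 0)%:E
   = (expR (- (a * b)) / a)%:E)%E.
Proof.
move=> a0; pose F t := - (a^-1 * expR (- (a * t))).
have dF (x : R) : is_derive x 1 F (expR (- (a * x))).
  apply: is_derive_eq.
  by rewrite /GRing.scale /= mulr1; field; rewrite gt_eqF.
have F0 : F x @[x --> +oo] --> 0.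
  rewrite -oppr0; apply: cvgN; rewrite -[X in _ --> X](mulr0 a^-1).
  apply: cvgMr; exact: cvg_expRN.
rewrite (integral_ray _ _ dF F0).
- by rewrite sub0r opprK mulrC.
- by move=> x _; exact: expR_ge0.
- exact: continuous_expRN.
Qed.

(** Half of the exponential absorbs the factor t: since e^(st/2) >= st/2, one has 0 <= t e^(-st) <=
    (2/s) e^(-st/2). *)
Lemma cvg_mul_expRN (s : R) : 0 < s -> t * expR (- (s * t)) @[t --> +oo] --> 0.
Proof.
move=> s0.
apply: (@squeeze_cvgr _ _ _ _ (fun=> 0) (fun t => 2 / s * expR (- (s / 2 * t)))).
- near=> t.
  have t0 : 0 < t by near: t; exact: nbhs_pinfty_gt.
  rewrite mulr_ge0 ?expR_ge0 ?(ltW t0)//=.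
  have -> : - (s * t) = - (s / 2 * t) + - (s / 2 * t) by field.
  rewrite expRD mulrA ler_pM2r ?expR_gt0//.
  rewrite expRN ler_pdivrMr ?expR_gt0//.
  have h := expR_ge1Dx (s / 2 * t).
  by rewrite -ler_pdivrMl ?divr_gt0// invf_div (le_trans _ h)// lerDr.
- exact: cvg_cst.
- rewrite -[X in _ --> X](mulr0 (2 / s)); apply: cvgMr.
  by apply: cvg_expRN; rewrite divr_gt0.
Unshelve. all: by end_near. Qed.

Lemma integral_id_expR (s : R) : 0 < s ->
  (\int[mu]_t (if 0 < t then t * expR (- (s * t)) else 0)%:E
   = (s ^- 2)%:E)%E.
Proof.
move=> s0.
(* Antiderivative found by integration by parts. *)
pose F t := - (s^-1 * (t * expR (- (s * t))) + s ^- 2 * expR (- (s * t))).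
have dF (x : R) : is_derive x 1 F (x * expR (- (s * x))).
  apply: is_derive_eq.
  by rewrite /GRing.scale /= ?scaler0 ?add0r !mulr1; field; rewrite gt_eqF.
have F0 : F x @[x --> +oo] --> 0.
  rewrite -oppr0; apply: cvgN; rewrite -[X in _ --> X](addr0 0); apply: cvgD.
    by rewrite -[X in _ --> X](mulr0 s^-1); apply: cvgMr; exact: cvg_mul_expRN.
  by rewrite -[X in _ --> X](mulr0 (s ^- 2)); apply: cvgMr; exact: cvg_expRN.
rewrite (integral_ray _ _ dF F0).
- by rewrite /F !(mulr0, mul0r) oppr0 expR0 sub0r opprK add0r mulr1.
- by move=> x x0; rewrite mulr_ge0 ?expR_ge0.
- by move=> x; apply: cvgM; [exact: cvg_id|exact: continuous_expRN].
Qed.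

(** Completing the square makes the integrand a multiple of the normal density of mean -b/a and
    variance 1/(2a), whose integral is 1. *)
Lemma integral_gaussian (a b : R) : 0 < a ->
  (\int[mu]_t (expR (- (a * t ^+ 2 + 2 * b * t)))%:E
   = (Num.sqrt (pi / a) * expR (b ^+ 2 / a))%:E)%E.
Proof.
move=> a0; pose sg := Num.sqrt (2 * a)^-1.
have a0' : a != 0 by rewrite gt_eqF.
have sg0 : sg != 0 by rewrite gt_eqF// sqrtr_gt0 invr_gt0 mulr_gt0.
have sgE : sg ^+ 2 = (2 * a)^-1 by rewrite sqr_sqrtr// invr_ge0 mulr_ge0// ltW.
have sp0 : 0 < Num.sqrt (pi / a) :> R by rewrite sqrtr_gt0 divr_gt0 ?pi_gt0.
have E t : expR (- (a * t ^+ 2 + 2 * b * t)) =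
    Num.sqrt (pi / a) * expR (b ^+ 2 / a) * normal_pdf (- b / a) sg t.
  rewrite normal_pdfE// /normal_peak /normal_fun sgE.
  have -> : (2 * a)^-1 * pi *+ 2 = pi / a by field.
  rewrite mulrACA divff ?gt_eqF// mul1r -expRD; congr expR; field.
  by [].
under eq_integral do rewrite E EFinM.
rewrite ge0_integralZl_EFin//.
- by rewrite integral_normal_pdf mule1.
- by move=> x _; rewrite lee_fin normal_pdf_ge0.
- by apply/measurable_EFinP; exact: measurable_normal_pdf.
Qed.

End integrals.

(** * Tonelli's theorem on a fivefold product *)
Section product_measure_sigma_finite.
Context d1 d2 (T1 : measurableType d1) (T2 : measurableType d2) (R : realType).
Variables (m1 : {sigma_finite_measure set T1 -> \bar R})
  (m2 : {sigma_finite_measure set T2 -> \bar R}).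

(* The library shadows the sigma-finiteness of [m1 \x m2] by an instance for
   subprobability measures; an alias carries it instead. *)
Definition product_measure := (m1 \x m2)%E.

HB.instance Definition _ := Measure.on product_measure.

(** The rectangles F_n x G_n exhaust the product because both exhaustions are increasing: a point of
    F_i x G_j lies in the rectangle of index max(i, j). *)
Lemma sigma_finite_product_measure : sigma_finite setT product_measure.
Proof.
have /sigma_finiteP[F [TF ndF Foo]] := sigma_finiteT m1.
have /sigma_finiteP[G [TG ndG Goo]] := sigma_finiteT m2.
exists (fun n => F n `*` G n) => [|n].
  apply/seteqP; split=> // -[x y] _.
  have [i _ Fix] : (\bigcup_n F n) x by rewrite -TF.
  have [j _ Gjy] : (\bigcup_n G n) y by rewrite -TG.
  exists (maxn i j) => //; split => /=.
  - by have /subsetPset := ndF _ _ (leq_maxl i j); apply.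
  - by have /subsetPset := ndG _ _ (leq_maxr i j); apply.
have [[mF Fy] [mG Gy]] := (Foo n, Goo n).
split; first exact: measurableX.
by rewrite /product_measure product_measure1E// lte_mul_pinfty// ge0_fin_numE.
Qed.

HB.instance Definition _ := Measure_isSigmaFinite.Build _ _ _ product_measure
  sigma_finite_product_measure.

End product_measure_sigma_finite.

(** For maps that only rearrange the components of nested pairs, possibly with some of them frozen
    to constants. *)
Ltac measurable_pairs :=
  do ?[apply/measurable_fun_pairP; split]; rewrite /comp /=;
  do ?[exact: measurable_fst | exact: measurable_snd | exact: measurable_id
     | exact: measurable_cst
     | apply: (measurableT_comp measurable_fst)
     | apply: (measurableT_comp measurable_snd)].

Section tonelli5.
Context d1 d2 d3 d4 d5 (T1 : measurableType d1) (T2 : measurableType d2)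
  (T3 : measurableType d3) (T4 : measurableType d4) (T5 : measurableType d5)
  (R : realType).
Variables (m1 : {sigma_finite_measure set T1 -> \bar R})
  (m2 : {sigma_finite_measure set T2 -> \bar R})
  (m3 : {sigma_finite_measure set T3 -> \bar R})
  (m4 : {sigma_finite_measure set T4 -> \bar R})
  (m5 : {sigma_finite_measure set T5 -> \bar R}).
Local Open Scope ereal_scope.

(** This order suits the dual cone: with t3, t4, t5 fixed, t1 and t2 run over rays; then t4 and t5
    give Gaussian integrals, and t3 comes last. *)
Lemma tonelli5 (f : T1 * T2 * T3 * T4 * T5 -> \bar R) :
    measurable_fun setT f -> (forall t, 0 <= f t) ->
  \int[m1 \x m2 \x m3 \x m4 \x m5]_t f t =
  \int[m3]_t3 \int[m5]_t5 \int[m4]_t4 \int[m2]_t2 \int[m1]_t1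
    f (t1, t2, t3, t4, t5).
Proof.
move=> mf f0.
pose f2 (t : T2 * T3 * T4 * T5) := \int[m1]_t1 f (t1, t.1.1.1, t.1.1.2, t.1.2, t.2).
have mf2 : measurable_fun setT f2.
  pose h (t : T1 * (T2 * T3 * T4 * T5)) := f (t.1, t.2.1.1.1, t.2.1.1.2, t.2.1.2, t.2.2).
  apply: (measurable_fun_fubini_tonelli_G (m1 := m1) h) => // [|t]; last exact: f0.
  apply: (measurableT_comp mf).
  by measurable_pairs.
have f20 t : 0 <= f2 t by apply: integral_ge0.
pose f3 (t : T3 * T4 * T5) := \int[m2]_t2 f2 (t2, t.1.1, t.1.2, t.2).
have mf3 : measurable_fun setT f3.
  pose h (t : T2 * (T3 * T4 * T5)) := f2 (t.1, t.2.1.1, t.2.1.2, t.2.2).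
  apply: (measurable_fun_fubini_tonelli_G (m1 := m2) h) => // [|t]; last exact: f20.
  apply: (measurableT_comp mf2).
  by measurable_pairs.
have f30 t : 0 <= f3 t by apply: integral_ge0.
(* Splitting off the last factor of the product repeatedly yields the order t5, t4, t3, t2, t1; the
   two innermost integrals form [f3]. *)
transitivity (\int[m5]_t5 \int[m4]_t4 \int[m3]_t3 f3 (t3, t4, t5)).
  rewrite (@fubini_tonelli2 _ _ _ _ _
    (product_measure (product_measure (product_measure m1 m2) m3) m4) m5 f mf f0).
  apply: eq_integral => t5 _.
  rewrite /fubini_G.
  have mf4 : measurable_fun setT (fun t => f (t, t5)) by exact: (measurableT_comp mf).
  rewrite (@fubini_tonelli2 _ _ _ _ _
    (product_measure (product_measure m1 m2) m3) m4 (fun t => f (t, t5)) mf4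
    (fun t => f0 (t, t5))).
  apply: eq_integral => t4 _; rewrite /fubini_G.
  have mf5 : measurable_fun setT (fun t => f (t, t4, t5)).
    by apply: (measurableT_comp mf); measurable_pairs.
  rewrite (@fubini_tonelli2 _ _ _ _ _
    (product_measure m1 m2) m3 (fun t => f (t, t4, t5)) mf5 (fun t => f0 (t, t4, t5))).
  apply: eq_integral => t3 _; rewrite /fubini_G.
  have mf6 : measurable_fun setT (fun t => f (t, t3, t4, t5)).
    by apply: (measurableT_comp mf); measurable_pairs.
  by rewrite (fubini_tonelli2 (fun t => f (t, t3, t4, t5)) mf6 (fun t => f0 (t, t3, t4, t5))).
(* Two exchanges bring t3 outermost, first past t4 and then past t5. *)
transitivity (\int[m5]_t5 \int[m3]_t3 \int[m4]_t4 f3 (t3, t4, t5)).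
  apply: eq_integral => t5 _.
  rewrite (fubini_tonelli (fun z : T4 * T3 => f3 (z.2, z.1, t5)))//.
  by apply: (measurableT_comp mf3); measurable_pairs.
rewrite (fubini_tonelli (fun z : T5 * T3 => \int[m4]_t4 f3 (z.2, t4, z.1)))//.
- pose h (t : T4 * (T5 * T3)) := f3 (t.2.2, t.1, t.2.1).
  apply: (measurable_fun_fubini_tonelli_G (m1 := m4) h) => // [|t]; last exact: f30.
  apply: (measurableT_comp mf3).
  by measurable_pairs.
- by move=> z; apply: integral_ge0.
Qed.
End tonelli5.

(** * The cone and its dual *)
Section cones.
Variable R : realType.
Implicit Types x t u : R.

Lemma inner_Vmat (x1 x2 x3 x4 x5 t1 t2 t3 t4 t5 : R) :
  inner (Vmat (x1, x2, x3, x4, x5)) (Vmat (t1, t2, t3, t4, t5)) =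
  x1 * t1 + x2 * t2 + x3 * t3 + 2 * (x4 * t4) + 2 * (x5 * t5).
Proof.
rewrite /inner /mxtrace !big_ord_recr big_ord0 /= !mxE.
by rewrite !big_ord_recr !big_ord0 /= !mxE /=; ring.
Qed.

(** The form u^T x u for x in V. Each summand is an entry of x times a factor depending on u only,
    so continuity in x can be read off term by term. *)
Definition quad (x1 x2 x3 x4 x5 u1 u2 u3 : R) :=
  x1 * u1 ^+ 2 + x2 * u2 ^+ 2 + x3 * u3 ^+ 2 + x4 * (2 * u1 * u3) + x5 * (2 * u2 * u3).

Definition col3 (u1 u2 u3 : R) : 'cV[R]_3 := \col_i nth 0 [:: u1; u2; u3] i.

Lemma quadE x1 x2 x3 x4 x5 u1 u2 u3 :
  let u := col3 u1 u2 u3 in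
  (u^T *m Vmat (x1, x2, x3, x4, x5) *m u) 0 0 = quad x1 x2 x3 x4 x5 u1 u2 u3.
Proof.
rewrite /=; do ?[rewrite !mxE ?big_ord_recr ?big_ord0 /=].
by rewrite /quad; ring.
Qed.

Lemma col3_surj (u : 'cV[R]_3) : exists u1 u2 u3, u = col3 u1 u2 u3.
Proof.
exists (u 0 0), (u 1 0), (u 2%:R 0).
apply/matrixP => i j; rewrite !mxE ord1.
case: i => [[|[|[|//]]] Hi] /=; congr (u _ _); exact/val_inj.
Qed.

Lemma Vmat_tr (s : R * R * R * R * R) : (Vmat s)^T = Vmat s.
Proof.
case: s => [[[[x1 x2] x3] x4] x5].
apply/matrixP => i j; rewrite !mxE.
case: i => [[|[|[|//]]] Hi]; case: j => [[|[|[|//]]] Hj] //.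
Qed.

Lemma posdef_VmatP x1 x2 x3 x4 x5 :
  posdef (Vmat (x1, x2, x3, x4, x5)) <->
  forall u1 u2 u3, [|| u1 != 0, u2 != 0 | u3 != 0] -> 0 < quad x1 x2 x3 x4 x5 u1 u2 u3.
Proof.
split=> [[_ h] u1 u2 u3 u0|h].
  rewrite -quadE; apply: h; apply: contraTneq u0 => u0.
  rewrite -!negb_and negbK; apply/and3P; split; apply/eqP.
  - by have := congr1 (fun v : 'cV[R]_3 => v 0 0) u0; rewrite !mxE.
  - by have := congr1 (fun v : 'cV[R]_3 => v 1 0) u0; rewrite !mxE.
  - by have := congr1 (fun v : 'cV[R]_3 => v 2%:R 0) u0; rewrite !mxE.
split; first exact: Vmat_tr.
move=> u; have [u1 [u2 [u3 ->]]] := col3_surj u => u0.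
rewrite quadE; apply: h; apply: contraNT u0.
rewrite -!negb_and negbK => /and3P[/eqP-> /eqP-> /eqP->].
apply/eqP/matrixP => i j; rewrite !mxE.
by case: i => [[|[|[|//]]] Hi].
Qed.

(** Weak inequalities between continuous functions pass to the closure, as they define closed
    sets. *)
Lemma closure_Omega_ge0 (f : 'M[R]_3 -> R) (x : 'M[R]_3) : continuous f ->
  (forall y, @Omega R y -> 0 <= f y) -> closure (@Omega R) x -> 0 <= f x.
Proof.
move=> cf f0 /(closure_subset f0).
have : closed [set y | 0 <= f y] by apply: (closed_comp _ (@closed_ge R 0)) => y _; exact: cf.
by rewrite closure_id => <-.
Qed.

Lemma continuous_entry (i j : 'I_3) : continuous (fun x : 'M[R]_3 => x i j).
Proof. exact: coord_continuous. Qed.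

Lemma closure_Omega_Vmat (x : 'M[R]_3) : closure (@Omega R) x ->
  exists x1 x2 x3 x4 x5, x = Vmat (x1, x2, x3, x4, x5) /\
    forall u1 u2 u3, 0 <= quad x1 x2 x3 x4 x5 u1 u2 u3.
Proof.
move=> cx.
(* An equation is a pair of weak inequalities, so the linear equations that define V also pass to
   the closure. *)
have eq0 (f : 'M[R]_3 -> R) : continuous f -> (forall q, f (Vmat q) = 0) -> f x = 0.
  move=> cf f0; apply/eqP; rewrite eq_le -oppr_ge0.
  apply/andP; split.
    apply: (closure_Omega_ge0 (f := fun y => - f y)) cx => [y|_ [[q _ <-] _]].
      exact/continuousN/cf.
    by rewrite f0 oppr0.
  by apply: (closure_Omega_ge0 (f := f)) cx => // _ [[q _ <-] _]; rewrite f0.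
have x01 : x 0 1 = 0.
  apply: (eq0 (fun y => y 0 1)); first exact: continuous_entry.
  by move=> [[[[? ?] ?] ?] ?]; rewrite !mxE.
have x10 : x 1 0 = 0.
  apply: (eq0 (fun y => y 1 0)); first exact: continuous_entry.
  by move=> [[[[? ?] ?] ?] ?]; rewrite !mxE.
have x20 : x 2%:R 0 - x 0 2%:R = 0.
  apply: (eq0 (fun y => y 2%:R 0 - y 0 2%:R)).
    by move=> y; apply: continuousB; exact: continuous_entry.
  by move=> [[[[? ?] ?] ?] ?]; rewrite !mxE subrr.
have x21 : x 2%:R 1 - x 1 2%:R = 0.
  apply: (eq0 (fun y => y 2%:R 1 - y 1 2%:R)).
    by move=> y; apply: continuousB; exact: continuous_entry.
  by move=> [[[[? ?] ?] ?] ?]; rewrite !mxE subrr.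
exists (x 0 0), (x 1 1), (x 2%:R 2%:R), (x 0 2%:R), (x 1 2%:R); split.
  have E (i j : nat) (Hi : (i < 3)%N) (Hj : (j < 3)%N) (i' j' : 'I_3) :
    i = i' -> j = j' -> x (Ordinal Hi) (Ordinal Hj) = x i' j'.
    by move=> ? ?; congr (x _ _); exact/val_inj.
  apply/matrixP => -[i Hi] [j Hj]; rewrite !mxE /=.
  move: i j Hi Hj => [|[|[|//]]] [|[|[|//]]] Hi Hj /=.
  - exact: E.
  - by rewrite -x01; exact: E.
  - exact: E.
  - by rewrite -x10; exact: E.
  - exact: E.
  - exact: E.
  - by move/eqP: x20; rewrite subr_eq0 => /eqP <-; exact: E.
  - by move/eqP: x21; rewrite subr_eq0 => /eqP <-; exact: E.
  - exact: E.
move=> u1 u2 u3.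
pose f (y : 'M[R]_3) := quad (y 0 0) (y 1 1) (y 2%:R 2%:R) (y 0 2%:R) (y 1 2%:R) u1 u2 u3.
apply: (@closure_Omega_ge0 f) cx.
  have cM (i j : 'I_3) (k : R) : continuous (fun y : 'M[R]_3 => y i j * k).
    move=> y; apply: (@continuous_comp _ _ _ (fun y : 'M[R]_3 => y i j) ( *%R^~ k)).
      exact: continuous_entry.
    exact: mulrr_continuous.
  have cD (g h : 'M[R]_3 -> R) : continuous g -> continuous h ->
    continuous (fun y => g y + h y).
    by move=> cg ch y; apply: continuousD; [exact: cg|exact: ch].
  exact: (cD _ _ (cD _ _ (cD _ _ (cD _ _ (cM 0 0 (u1 ^+ 2))
    (cM 1 1 (u2 ^+ 2))) (cM 2%:R 2%:R (u3 ^+ 2))) (cM 0 2%:R (2 * u1 * u3)))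
    (cM 1 2%:R (2 * u2 * u3))).
move=> _ [[[[[[x1 x2] x3] x4] x5] _ <-] [_ h]]; rewrite /f !mxE /=.
rewrite -quadE; have [->|u0] := eqVneq (col3 u1 u2 u3) 0; last exact/ltW/h.
by rewrite mulmx0 mxE.
Qed.

(** A positive semidefinite x is the limit of the positive definite matrices x + e I as e decreases
    to 0, and these stay in V. *)
Lemma psd_closure_Omega x1 x2 x3 x4 x5 :
  (forall u1 u2 u3, 0 <= quad x1 x2 x3 x4 x5 u1 u2 u3) ->
  closure (@Omega R) (Vmat (x1, x2, x3, x4, x5)).
Proof.
move=> h B nB.
have cv : Vmat (x1, x2, x3, x4, x5) + e *: 1%:M @[e --> 0^'+] --> Vmat (x1, x2, x3, x4, x5).
  rewrite -[X in _ --> X]addr0; apply: cvgD; first exact: cvg_cst.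
  rewrite -[X in _ --> X](scale0r 1%:M).
  apply: cvgZr_tmp; exact: cvg_at_right_filter.
have : \forall e \near 0^'+, B (Vmat (x1, x2, x3, x4, x5) + e *: 1%:M) by exact: cv nB.
move=> nBe; near (0 : R)^'+ => e.
have e0 : 0 < e by [].
exists (Vmat (x1, x2, x3, x4, x5) + e *: 1%:M); split; last by near: e.
have -> : Vmat (x1, x2, x3, x4, x5) + e *: 1%:M = Vmat (x1 + e, x2 + e, x3 + e, x4, x5).
  apply/matrixP => i j; rewrite !mxE.
  case: i => [[|[|[|//]]] Hi]; case: j => [[|[|[|//]]] Hj] /=;
    by rewrite ?mulr1 ?mulr0 ?addr0.
split; first by exists (x1 + e, x2 + e, x3 + e, x4, x5).
apply/posdef_VmatP => u1 u2 u3 u0.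
have -> : quad (x1 + e) (x2 + e) (x3 + e) x4 x5 u1 u2 u3 =
  quad x1 x2 x3 x4 x5 u1 u2 u3 + e * (u1 ^+ 2 + u2 ^+ 2 + u3 ^+ 2) by rewrite /quad; ring.
rewrite ltr_wpDl// mulr_gt0//.
move: u0 => /or3P[] u0.
- by rewrite -addrA ltr_pwDl// ?exprn_even_gt0// addr_ge0// sqr_ge0.
- by rewrite ltr_wpDr ?sqr_ge0// ltr_wpDl ?sqr_ge0// exprn_even_gt0.
- by rewrite ltr_wpDl ?exprn_even_gt0// addr_ge0// sqr_ge0.
Unshelve. all: by end_near. Qed.

(** Necessity follows by testing against the rank-one matrices w w^T that lie in V. Sufficiency
    rests on the identity t3 (x|t) = u^T x u + x1 (t1 t3 - t4^2) + x2 (t2 t3 - t5^2) with u = (t4,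
    t5, t3). *)
Lemma dual_OmegaP t1 t2 t3 t4 t5 :
  dual_Omega (Vmat (t1, t2, t3, t4, t5)) <->
  [/\ 0 < t3, t4 ^+ 2 < t1 * t3 & t5 ^+ 2 < t2 * t3].
Proof.
split=> [[_ h]|[t3_gt0 h1 h2]].
  (* The condition w1 w2 = 0 puts w w^T in V; its pairing with t is the value at w of the form of
     t. *)
  have pos w1 w2 w3 : w1 * w2 = 0 -> [|| w1 != 0, w2 != 0 | w3 != 0] ->
      0 < quad t1 t2 t3 t4 t5 w1 w2 w3.
    move=> w12 w0.
    have -> : quad t1 t2 t3 t4 t5 w1 w2 w3 =
      inner (Vmat (w1 ^+ 2, w2 ^+ 2, w3 ^+ 2, w1 * w3, w2 * w3)) (Vmat (t1, t2, t3, t4, t5)).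
      by rewrite inner_Vmat /quad; ring.
    apply: h; split.
      apply: psd_closure_Omega => u1 u2 u3.
      have -> : quad (w1 ^+ 2) (w2 ^+ 2) (w3 ^+ 2) (w1 * w3) (w2 * w3) u1 u2 u3
         = (w1 * u1 + w2 * u2 + w3 * u3) ^+ 2 - 2 * (w1 * w2) * u1 * u2 by rewrite /quad; ring.
      by rewrite w12 mulr0 !mul0r subr0 sqr_ge0.
    move=> /= w0'; move: w0; apply/negP; rewrite -!negb_and negbK.
    apply/and3P; split; rewrite -sqrf_eq0; apply/eqP.
    - by have := congr1 (fun v : 'M[R]_3 => v 0 0) w0'; rewrite !mxE.
    - by have := congr1 (fun v : 'M[R]_3 => v 1 1) w0'; rewrite !mxE.
    - by have := congr1 (fun v : 'M[R]_3 => v 2%:R 2%:R) w0'; rewrite !mxE.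
  have t3_gt0 : 0 < t3.
    have := pos 0 0 1 (mul0r 0); rewrite oner_eq0 !orbT => /(_ isT).
    by rewrite /quad; lra.
  split=> //.
  (* Up to scale, w = (t3, 0, -t4) minimizes the form of t in w3 for fixed w1 and w2 = 0, so that
     the 2 x 2 minor appears. *)
  - have := pos t3 0 (- t4) (mulr0 _); rewrite (gt_eqF t3_gt0) => /(_ isT).
    have -> : quad t1 t2 t3 t4 t5 t3 0 (- t4) = t3 * (t1 * t3 - t4 ^+ 2)
      by rewrite /quad; ring.
    by rewrite pmulr_rgt0// subr_gt0.
  - have := pos 0 t3 (- t5) (mul0r _); rewrite (gt_eqF t3_gt0) orbT => /(_ isT).
    have -> : quad t1 t2 t3 t4 t5 0 t3 (- t5) = t3 * (t2 * t3 - t5 ^+ 2)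
      by rewrite /quad; ring.
    by rewrite pmulr_rgt0// subr_gt0.
split; first by exists (t1, t2, t3, t4, t5).
move=> _ [/closure_Omega_Vmat[x1 [x2 [x3 [x4 [x5 [-> q]]]]]] /= x0].
rewrite inner_Vmat -(pmulr_rgt0 _ t3_gt0).
have -> : t3 * (x1 * t1 + x2 * t2 + x3 * t3 + 2 * (x4 * t4) + 2 * (x5 * t5)) =
  quad x1 x2 x3 x4 x5 t4 t5 t3 + (x1 * (t1 * t3 - t4 ^+ 2) + x2 * (t2 * t3 - t5 ^+ 2)).
  by rewrite /quad; ring.
have x1_ge0 : 0 <= x1 by have := q 1 0 0; rewrite /quad; lra.
have x2_ge0 : 0 <= x2 by have := q 0 1 0; rewrite /quad; lra.
have x3_ge0 : 0 <= x3 by have := q 0 0 1; rewrite /quad; lra.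
(* If x1 or x2 is positive, its minor makes the sum positive; otherwise x3 is the only entry left
   that can be nonzero. *)
have [x1_gt0|x1_le0] := ltP 0 x1.
  by rewrite ltr_wpDl// ltr_pwDl ?mulr_ge0 ?mulr_gt0 ?subr_ge0 ?subr_gt0// ltW.
have [x2_gt0|x2_le0] := ltP 0 x2.
  by rewrite ltr_wpDl// ltr_wpDl ?mulr_ge0 ?mulr_gt0 ?subr_ge0 ?subr_gt0// ltW.
have x1_0 : x1 = 0 by apply/le_anti/andP.
have x2_0 : x2 = 0 by apply/le_anti/andP.
(* A vanishing diagonal entry of a positive semidefinite form kills its row. *)
have off (y : R) : (forall a, 0 <= 2 * a * y + x3) -> y = 0.
  move=> hy; have [//|y0] := eqVneq y 0.
  have := hy (- (x3 + 1) / (2 * y)).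
  have -> : 2 * (- (x3 + 1) / (2 * y)) * y + x3 = - 1 by field.
  by lra.
have x4_0 : x4 = 0.
  by apply: off => a; have := q a 0 1; rewrite /quad x1_0 x2_0; lra.
have x5_0 : x5 = 0.
  by apply: off => a; have := q 0 a 1; rewrite /quad x1_0 x2_0; lra.
have x3_gt0 : 0 < x3.
  rewrite lt_neqAle x3_ge0 andbT eq_sym; apply: contra_notN x0 => /eqP x3_0.
  rewrite x1_0 x2_0 x3_0 x4_0 x5_0; apply/matrixP => i j; rewrite !mxE.
  by case: i => [[|[|[|//]]] Hi]; case: j => [[|[|[|//]]] Hj].
rewrite x1_0 x2_0 !mul0r !addr0 /quad x4_0 x5_0 !mul0r !add0r !addr0.
by rewrite mulr_gt0// exprn_gt0.
Qed.

End cones.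

(** * The characteristic function *)
Section charfun_integral.
Variables (R : realType) (c : {posnum R}) (x1 x2 x3 x4 x5 : R).
Notation mu := (@lebesgue_measure R).
(** Schur complement of the block diag(x1, x2), so that det x = x1 x2 s. *)
Let s := x3 - x4 ^+ 2 / x1 - x5 ^+ 2 / x2.
Hypotheses (x1_gt0 : 0 < x1) (x2_gt0 : 0 < x2) (s_gt0 : 0 < s).

Let T5 := (measurableTypeR R * measurableTypeR R * measurableTypeR R *
  measurableTypeR R * measurableTypeR R)%type.

(** The integrand extended by zero outside the dual cone; the projections [t.1.1.1.1], [t.1.1.1.2],
    [t.1.1.2], [t.1.2], [t.2] are t1, ..., t5. *)
Let f (t : T5) : R :=
  if [&& 0 < t.1.1.2, t.1.2 ^+ 2 < t.1.1.1.1 * t.1.1.2 &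
         t.2 ^+ 2 < t.1.1.1.2 * t.1.1.2] then
    expR (- (x1 * t.1.1.1.1 + x2 * t.1.1.1.2 + x3 * t.1.1.2 +
             2 * (x4 * t.1.2) + 2 * (x5 * t.2)))
  else 0.

Let mf : measurable_fun setT (EFin \o f).
Proof.
have m1 : measurable_fun setT (fun t : T5 => t.1.1.1.1) by measurable_pairs.
have m2 : measurable_fun setT (fun t : T5 => t.1.1.1.2) by measurable_pairs.
have m3 : measurable_fun setT (fun t : T5 => t.1.1.2) by measurable_pairs.
have m4 : measurable_fun setT (fun t : T5 => t.1.2) by measurable_pairs.
have m5 : measurable_fun setT (fun t : T5 => t.2) by measurable_pairs.
apply/measurable_EFinP; apply: measurable_fun_ifT.
- apply: measurable_and; first exact: measurable_fun_ltr.
  apply: measurable_and; apply: measurable_fun_ltr.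
  + exact: measurable_funX.
  + exact: measurable_funM.
  + exact: measurable_funX.
  + exact: measurable_funM.
- apply: measurableT_comp => //; apply: measurableT_comp => //.
  do 4?[apply: measurable_funD].
  all: do ?[apply: measurable_funM => //].
- exact: measurable_cst.
Qed.

Let integral_dual_Omega :
  (\int[lebesgueV c]_(t in @Vmat R @^-1` @dual_Omega R)
     (expR (- inner (Vmat (x1, x2, x3, x4, x5)) (Vmat t)))%:E
   = (c%:num)%:E * \int[mu \x mu \x mu \x mu \x mu]_t (f t)%:E)%E.
Proof.
rewrite integral_mkcond (_ : _ \_ _ = EFin \o f); last first.
  apply/funext => -[[[[t1 t2] t3] t4] t5]; rewrite patchE /f /= inner_Vmat.
  case: ifPn => [/set_mem/dual_OmegaP[-> -> ->]//|].
  rewrite notin_setE => h; rewrite ifF//; apply/negP => /and3P[h3 h1 h2].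
  by apply: h; apply/dual_OmegaP.
rewrite ge0_integral_mscale//= => t _.
by rewrite /f lee_fin; case: ifP => // _; exact: expR_ge0.
Qed.

(** With a = t3, the normalizations of the two Gaussian integrals multiply to a first power of t3,
    which turns the last integral into that of t e^(-st). *)
Let sqrt_pi (a : R) : 0 < a ->
  Num.sqrt (pi / (x1 / a)) * Num.sqrt (pi / (x2 / a)) = pi / Num.sqrt (x1 * x2) * a.
Proof.
move=> a0; rewrite -sqrtrM; last by rewrite !divr_ge0 ?pi_ge0 ?ltW.
have -> : pi / (x1 / a) * (pi / (x2 / a)) = (pi * a) ^+ 2 / (x1 * x2) :> R.
  by field; rewrite !gt_eqF.
rewrite sqrtrM ?sqr_ge0// sqrtr_sqr ger0_norm; last by rewrite mulr_ge0 ?pi_ge0 ?ltW.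
by rewrite sqrtrV ?mulr_ge0 ?ltW// mulrAC.
Qed.

Let integral_f : (\int[mu \x mu \x mu \x mu \x mu]_t (f t)%:E =
  (pi / (x1 * x2 * Num.sqrt (x1 * x2) * s ^+ 2))%:E)%E.
Proof.
rewrite (@tonelli5 _ _ _ _ _ _ _ _ _ _ R mu mu mu mu mu (EFin \o f) mf); last first.
  by move=> t; rewrite lee_fin /f; case: ifP => // _; exact: expR_ge0.
pose C := pi / (x1 * x2 * Num.sqrt (x1 * x2)).
have C0 : 0 <= C.
  by rewrite divr_ge0 ?pi_ge0// !mulr_ge0 ?sqrtr_ge0 ?ltW.
transitivity (\int[mu]_t (C%:E * (if 0 < t then t * expR (- (s * t)) else 0)%:E))%E.
  apply: eq_integral => t3 _.
  case: ifPn => [t3_gt0|t3_le0]; last first.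
    rewrite mule0; apply: integral0_eq => t5 _; apply: integral0_eq => t4 _.
    apply: integral0_eq => t2 _; apply: integral0_eq => t1 _.
    by rewrite /f/= (negbTE t3_le0).
  have t3n0 : t3 != 0 by rewrite gt_eqF.
  have x1n0 : x1 != 0 by rewrite gt_eqF.
  have x2n0 : x2 != 0 by rewrite gt_eqF.
  (* For fixed t3 > 0 the cone conditions confine t1 and t2 to rays starting at t4^2/t3 and t5^2/t3.
     Integrating over these rays supplies the quadratic terms of the Gaussians in t4 and t5. *)
  pose k1 t1 t4 := if t4 ^+ 2 / t3 < t1 then expR (- (x1 * t1)) else 0.
  pose k2 t2 t5 := if t5 ^+ 2 / t3 < t2 then expR (- (x2 * t2)) else 0.
  have k1_ge0 t1 t4 : 0 <= k1 t1 t4 by rewrite /k1; case: ifP => // _; exact: expR_ge0.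
  have k2_ge0 t2 t5 : 0 <= k2 t2 t5 by rewrite /k2; case: ifP => // _; exact: expR_ge0.
  have mk (a b : R) : measurable_fun setT (fun t : R => if b < t then expR (- (a * t)) else 0).
    apply: measurable_fun_ifT.
    - exact: measurable_fun_ltr.
    - by apply: measurableT_comp => //; apply: measurableT_comp.
    - exact: measurable_cst.
  have fE t1 t2 t4 t5 : f (t1, t2, t3, t4, t5) =
      expR (- (x3 * t3)) * expR (- (2 * x5 * t5)) * expR (- (2 * x4 * t4)) *
      k2 t2 t5 * k1 t1 t4.
    rewrite /f /k1 /k2 /= t3_gt0 !ltr_pdivrMr//.
    case: (t4 ^+ 2 < t1 * t3); last by rewrite mulr0.
    case: (t5 ^+ 2 < t2 * t3); last by rewrite mulr0 mul0r.
    by rewrite -!expRD; congr expR; ring.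
  have i1 t2 t4 t5 : (\int[mu]_t1 (f (t1, t2, t3, t4, t5))%:E =
     (expR (- (x3 * t3)) * expR (- (2 * x5 * t5)) * expR (- (2 * x4 * t4)) *
       (expR (- (x1 * (t4 ^+ 2 / t3))) / x1) * k2 t2 t5)%:E)%E.
    under eq_integral do rewrite fE EFinM.
    rewrite ge0_integralZl_EFin//.
    - by rewrite integral_expR_ray// -EFinM; congr EFin; ring.
    - by move=> t _; rewrite lee_fin.
    - by apply/measurable_EFinP; exact: mk.
    - by rewrite !mulr_ge0 ?expR_ge0.
  have i2 t4 t5 : (\int[mu]_t2 \int[mu]_t1 (f (t1, t2, t3, t4, t5))%:E =
     (expR (- (x3 * t3)) * expR (- (2 * x5 * t5)) / x1 / x2 * expR (- (x2 * (t5 ^+ 2 / t3))) *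
      expR (- (x1 / t3 * t4 ^+ 2 + 2 * x4 * t4)))%:E)%E.
    under eq_integral do rewrite i1 EFinM.
    rewrite ge0_integralZl_EFin//.
    - rewrite integral_expR_ray// -EFinM; congr EFin.
      have -> : - (x1 / t3 * t4 ^+ 2 + 2 * x4 * t4) = - (2 * x4 * t4) - (x1 * (t4 ^+ 2 / t3)).
        by ring.
      by rewrite [expR (_ - _)]expRD; ring.
    - by move=> t _; rewrite lee_fin.
    - by apply/measurable_EFinP; exact: mk.
    - by rewrite !mulr_ge0 ?invr_ge0 ?expR_ge0// ltW.
  have i4 t5 : (\int[mu]_t4 \int[mu]_t2 \int[mu]_t1 (f (t1, t2, t3, t4, t5))%:E =
     (expR (- (x3 * t3)) / x1 / x2 * (Num.sqrt (pi / (x1 / t3)) * expR (x4 ^+ 2 / (x1 / t3))) *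
      expR (- (x2 / t3 * t5 ^+ 2 + 2 * x5 * t5)))%:E)%E.
    under eq_integral do rewrite i2 EFinM.
    rewrite ge0_integralZl_EFin//.
    - rewrite integral_gaussian ?divr_gt0// -EFinM; congr EFin.
      have -> : - (x2 / t3 * t5 ^+ 2 + 2 * x5 * t5) = - (2 * x5 * t5) - (x2 * (t5 ^+ 2 / t3)).
        by ring.
      by rewrite [expR (_ - _)]expRD; ring.
    - apply/measurable_EFinP; apply: measurableT_comp => //; apply: measurableT_comp => //.
      by apply: measurable_funD; apply: measurable_funM.
    - by rewrite !mulr_ge0 ?invr_ge0 ?expR_ge0// ltW.
  under eq_integral do rewrite i4 EFinM.
  rewrite ge0_integralZl_EFin//.
  - rewrite integral_gaussian ?divr_gt0// -!EFinM; congr EFin.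
    set e3 := expR (- (x3 * t3)); set e4 := expR (x4 ^+ 2 / (x1 / t3)).
    set e5 := expR (x5 ^+ 2 / (x2 / t3)).
    (* Completing the squares in t4 and t5 has corrected the exponent -x3 t3 to -s t3. *)
    have -> : expR (- (s * t3)) = e3 * e4 * e5.
      by rewrite -!expRD; congr expR; rewrite /s; field; rewrite !gt_eqF.
    have := sqrt_pi t3_gt0.
    set S1 := Num.sqrt (pi / (x1 / t3)); set S2 := Num.sqrt (pi / (x2 / t3)) => S12.
    have -> : C * (t3 * (e3 * e4 * e5)) =
        (pi / Num.sqrt (x1 * x2) * t3) / x1 / x2 * (e3 * e4 * e5).
      by rewrite /C !invfM; ring.
    by rewrite -S12; ring.
  - apply/measurable_EFinP; apply: measurableT_comp => //; apply: measurableT_comp => //.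
    by apply: measurable_funD; apply: measurable_funM.
  - by rewrite !mulr_ge0 ?invr_ge0 ?expR_ge0 ?sqrtr_ge0// ltW.
rewrite ge0_integralZl_EFin//.
- by rewrite integral_id_expR// -EFinM; congr EFin; rewrite /C !invfM; ring.
- by move=> t _; rewrite lee_fin; case: ifP => // t0; rewrite mulr_ge0 ?expR_ge0// ltW.
- apply/measurable_EFinP; apply: measurable_fun_ifT.
  + exact: measurable_fun_ltr.
  + apply: measurable_funM => //.
    by apply: measurableT_comp => //; apply: measurableT_comp.
  + exact: measurable_cst.
Qed.

Lemma charfun_Vmat : charfun c (Vmat (x1, x2, x3, x4, x5)) =
  c%:num * (pi / (x1 * x2 * Num.sqrt (x1 * x2) * s ^+ 2)).
Proof. by rewrite /charfun /Rintegral integral_dual_Omega integral_f. Qed.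

End charfun_integral.

(** * The metric in the direction E11 *)
Section metric_e11.
Variables (R : realType) (c : {posnum R}) (x2 x3 x4 x5 : R).
Hypothesis x2_gt0 : 0 < x2.
(** Chosen so that det (L t) = x2 (t r - x4^2). *)
Let r := x3 - x5 ^+ 2 / x2.
Let L t := Vmat (t, x2, x3, x4, x5).
Let E11 : 'M[R]_3 := Vmat (1, 0, 0, 0, 0).

(** [L] is affine with direction E11, so the two difference quotients coincide and only one-variable
    derivatives remain. *)
Let derive_L (F : 'M[R]_3 -> R) (t : R) : 'D_E11 F (L t) = 'D_1 (F \o L) t.
Proof.
rewrite /derive; apply: (congr1 (fun f : R -> R => lim (f @ 0^'))).
apply/funext => h /=.
congr (_ *: (F _ - _)); apply/matrixP => i j; rewrite !mxE.
case: i => [[|[|[|//]]] Hi]; case: j => [[|[|[|//]]] Hj] /=;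
  by rewrite ?mulr0 ?add0r.
Qed.

(** The logarithm of the characteristic function along [L], its first summand gathering all that is
    independent of t. *)
Let g t := ln (c%:num * pi / (x2 * Num.sqrt x2)) + (2^-1 * ln t - 2 * ln (t * r - x4 ^+ 2)).

(** As x2 > 0, this says that L t is positive definite. *)
Let dom (t : R) := (0 < t) && (x4 ^+ 2 < t * r).

Let ln_charfun_L t : dom t -> ln (charfun c (L t)) = g t.
Proof.
move=> /andP[t0 tr].
have d0 : 0 < t * r - x4 ^+ 2 by rewrite subr_gt0.
have sE : x3 - x4 ^+ 2 / t - x5 ^+ 2 / x2 = (t * r - x4 ^+ 2) / t.
  by rewrite /r; field; rewrite !gt_eqF.
have c0 : 0 < c%:num * pi / (x2 * Num.sqrt x2) :> R.
  by rewrite !(divr_gt0, mulr_gt0) ?pi_gt0 ?sqrtr_gt0.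
rewrite charfun_Vmat ?sE ?divr_gt0//.
have -> : c%:num * (pi / (t * x2 * Num.sqrt (t * x2) * ((t * r - x4 ^+ 2) / t) ^+ 2))
  = c%:num * pi / (x2 * Num.sqrt x2) * (t / Num.sqrt t / (t * r - x4 ^+ 2) ^+ 2).
  rewrite sqrtrM ?ltW//; field.
  by rewrite !gt_eqF ?sqrtr_gt0.
have -> : t / Num.sqrt t = Num.sqrt t.
  by rewrite -[X in X / _](sqr_sqrtr (ltW t0)) expr2 mulfK// gt_eqF// sqrtr_gt0.
rewrite lnM ?posrE// ?divr_gt0 ?sqrtr_gt0 ?exprn_gt0//.
rewrite [ln (Num.sqrt t / _)]ln_div ?posrE ?sqrtr_gt0 ?exprn_gt0// lnXn// -mulr_natl.
rewrite /g; congr (_ + (_ - _)).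
rewrite -[X in _ = _ * ln X](sqr_sqrtr (ltW t0)) lnXn ?sqrtr_gt0//.
by field.
Qed.

Let near_dom t : dom t -> \near t, dom t.
Proof.
move=> /andP[t0 tr]; near=> u; apply/andP; split.
  by near: u; exact: lt_nbhsr.
near: u; apply: (@cvgr_gt _ _ _ _ ( *%R^~ r) (t * r)) => //.
exact: mulrr_continuous.
Unshelve. all: by end_near. Qed.

Let dg t : dom t -> is_derive t 1 g (2^-1 * t^-1 - 2 * (r / (t * r - x4 ^+ 2))).
Proof.
move=> /andP[t0 tr].
have d0 : 0 < t * r - x4 ^+ 2 by rewrite subr_gt0.
have d1 : is_derive t 1 (@ln R) t^-1 by exact: is_derive1_ln.
have dl : is_derive t 1 (fun t => t * r - x4 ^+ 2) r.
  by apply: is_derive_eq; rewrite /GRing.scale /= ?scaler0 ?mulr1; ring.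
have dln : is_derive (t * r - x4 ^+ 2) 1 (@ln R) (t * r - x4 ^+ 2)^-1 by exact: is_derive1_ln.
have d2 : is_derive t 1 (fun t => ln (t * r - x4 ^+ 2)) ((t * r - x4 ^+ 2)^-1 * r).
  exact: (@is_derive1_comp _ (@ln R) (fun t => t * r - x4 ^+ 2)).
apply: is_derive_eq.
by rewrite /GRing.scale /=; ring.
Qed.

Let ddg t : dom t ->
  is_derive t 1 (fun t => 2^-1 * t^-1 - 2 * (r / (t * r - x4 ^+ 2)))
    (- (2^-1 / t ^+ 2) + 2 * (r / (t * r - x4 ^+ 2)) ^+ 2).
Proof.
move=> /andP[t0 tr].
have d0 : 0 < t * r - x4 ^+ 2 by rewrite subr_gt0.
have dl : is_derive t 1 (fun t => t * r - x4 ^+ 2) r.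
  by apply: is_derive_eq; rewrite /GRing.scale /= ?scaler0 ?mulr1; ring.
have d1 : is_derive t 1 (fun t => t^-1) _ := is_deriveV (lt0r_neq0 t0) (is_derive_id t 1).
have d2 : is_derive t 1 (fun t => (t * r - x4 ^+ 2)^-1) _ :=
  @is_deriveV _ (fun t => t * r - x4 ^+ 2) t r 1 (lt0r_neq0 d0) dl.
apply: is_derive_eq.
rewrite /GRing.scale /= ?scaler0; field.
by rewrite !gt_eqF.
Qed.

Lemma metric_E11 x1 : 0 < x1 -> x4 ^+ 2 < x1 * (x3 - x5 ^+ 2 / x2) ->
  metric c (Vmat (x1, x2, x3, x4, x5)) E11 E11 =
  - (2^-1 / x1 ^+ 2) +
  2 * ((x3 - x5 ^+ 2 / x2) / (x1 * (x3 - x5 ^+ 2 / x2) - x4 ^+ 2)) ^+ 2.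
Proof.
move=> x1_gt0 h; have dx1 : dom x1 by exact/andP.
rewrite /metric (derive_L _ x1).
have dd := ddg dx1.
rewrite -/r -[RHS](derive_val (is_derive := dd)).
(* The closed formulas hold on [dom] only. This set is open, so they may be substituted near the
   point, first under the outer and then under the inner derivative. *)
apply: near_eq_derive; near=> t => /=.
have dt : dom t by near: t; exact: near_dom.
rewrite derive_L -[RHS](derive_val (is_derive := dg dt)).
apply: near_eq_derive; near=> u => /=.
by apply: ln_charfun_L; near: u; exact: near_dom.
Unshelve. all: by end_near. Qed.

End metric_e11.

(** * Translations *)
Section translation.
Variable R : realType.
Implicit Types b z v : 'M[R]_3.

Definition translation b : 'M[R]_(3 + 3) := block_mx 1%:M b 0 1%:M.

Lemma denom_translation b z : denom (translation b) z = 1%:M.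
Proof. by rewrite /denom /translation block_mxKdl block_mxKdr mul0mx add0r. Qed.

Lemma act_translation b z : act (translation b) z = z + b.
Proof.
rewrite /act denom_translation invmx1 mulmx1.
by rewrite /translation block_mxKul block_mxKur mul1mx.
Qed.

Lemma jac_translation b z v : jac (translation b) z v = v.
Proof.
rewrite /jac (_ : act _ = id + cst b); last first.
  by apply/funext => y; rewrite act_translation.
have dz : is_diff z (id + cst b) (id + 0) := is_diffD (is_diff_id z) (is_diff_cst b z).
by rewrite (diff_val (is_diff_def := dz)) /= addr0.
Qed.

Lemma Vmat_add x1 x2 x3 x4 x5 y1 y2 y3 y4 y5 :
  Vmat (x1, x2, x3, x4, x5) + Vmat (y1, y2, y3, y4, y5) =
  Vmat (x1 + y1, x2 + y2, x3 + y3, x4 + y4, x5 + y5) :> 'M[R]_3.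
Proof.
apply/matrixP => i j; rewrite !mxE.
by case: i => [[|[|[|//]]] Hi]; case: j => [[|[|[|//]]] Hj] /=; rewrite ?addr0.
Qed.

Lemma G_translation b : V b -> G (translation b).
Proof.
move=> Vb; have bT : b^T = b by case: Vb => q _ <-; exact: Vmat_tr.
have H'1 : H' (1%:M : 'M[R]_3).
  exists 1, 1, 1, 0, 0; split=> //; apply/matrixP => i j; rewrite !mxE.
  by case: i => [[|[|[|//]]] Hi]; case: j => [[|[|[|//]]] Hj].
rewrite /G /= /translation block_mxKul block_mxKur block_mxKdl block_mxKdr trmx1.
split=> //.
- split; first by rewrite unitmxE det_ublock !det1 mulr1 unitr1.
  rewrite tr_block_mx trmx1 trmx0 bT /Jmx !mulmx_block.
  rewrite !(mul1mx, mulmx1, mul0mx, mulmx0, add0r, addr0, mulNmx, mulmxN).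
  by rewrite subrr.
- by case: Vb => -[[[[b1 b2] b3] b4] b5] _ <-; exists b1, b2, b3, b4, b5, b4, b5.
- exists 0, 0; apply/matrixP => i j; rewrite !mxE.
  by case: i => [[|[|[|//]]] Hi]; case: j => [[|[|[|//]]] Hj].
Qed.

(** Adding a positive semidefinite form to a positive definite one keeps it positive definite, and
    the denominator of a translation is the identity. *)
Lemma Gamma_translation (b1 b2 b3 b4 b5 : R) :
  (forall u1 u2 u3 : R, 0 <= quad b1 b2 b3 b4 b5 u1 u2 u3) ->
  Gamma (translation (Vmat (b1, b2, b3, b4, b5))).
Proof.
move=> b_ge0; split; first by apply: G_translation; eexists.
move=> _ [[[[[[x1 x2] x3] x4] x5] _ <-] /posdef_VmatP x_gt0].
rewrite denom_translation unitmx1 act_translation Vmat_add; split=> //.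
split; first by eexists.
apply/posdef_VmatP => u1 u2 u3 u0.
have -> : quad (x1 + b1) (x2 + b2) (x3 + b3) (x4 + b4) (x5 + b5) u1 u2 u3 =
    quad x1 x2 x3 x4 x5 u1 u2 u3 + quad b1 b2 b3 b4 b5 u1 u2 u3.
  by rewrite /quad; ring.
by rewrite ltr_wpDr// x_gt0.
Qed.

End translation.

(** * A translation that lengthens a tangent vector *)

Theorem mainTheorem3 (R : realType) (c : {posnum R}) :
  exists (g : 'M[R]_(3 + 3)) (x v : 'M[R]_3),
    [/\ Gamma g, Omega x, V v &
        metric c x v v < metric c (act g x) (jac g x v) (jac g x v)].
Proof.
exists (translation (Vmat (1, 0, 4, 2, 0))), (Vmat (1, 1, 2, 1, 0)), (Vmat (1, 0, 0, 0, 0)).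
split.
- apply: Gamma_translation => u1 u2 u3.
  have -> : quad 1 0 4 2 0 u1 u2 u3 = (u1 + 2 * u3) ^+ 2 by rewrite /quad; ring.
  exact: sqr_ge0.
- split; first by eexists.
  apply/posdef_VmatP => u1 u2 u3 u0.
  have -> : quad 1 1 2 1 0 u1 u2 u3 = (u1 + u3) ^+ 2 + u2 ^+ 2 + u3 ^+ 2.
    by rewrite /quad; ring.
  rewrite lt_neqAle !addr_ge0 ?sqr_ge0// andbT eq_sym.
  apply: contraTneq u0 => /eqP.
  rewrite !paddr_eq0 ?addr_ge0 ?sqr_ge0// !sqrf_eq0 =>
    /andP[/andP[/eqP u13 /eqP u2_0] /eqP u3_0].
  by move: u13; rewrite u3_0 u2_0 addr0 => ->; rewrite eqxx.
- by eexists.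
- rewrite act_translation jac_translation Vmat_add.
  (* The quotient squared in [metric_E11] is the (1,1) entry of the inverse matrix. It equals 2 at
     both points, so only the term -1/(2 x1^2) changes, from -1/2 to -1/8. *)
  have -> : metric c (Vmat (1, 1, 2, 1, 0)) (Vmat (1, 0, 0, 0, 0))
      (Vmat (1, 0, 0, 0, 0)) = 15 / 2.
    by rewrite metric_E11 // ?expr0n /= ?mul0r ?subr0; [field|lra].
  have -> : metric c (Vmat (1 + 1, 1 + 0, 2 + 4, 1 + 2, 0 + 0))
      (Vmat (1, 0, 0, 0, 0)) (Vmat (1, 0, 0, 0, 0)) = 63 / 8.
    by rewrite !addr0 metric_E11 // ?expr0n /= ?mul0r ?subr0; [field|lra].
  by lra.
Qed.
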